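(* Let $\Sigma$ be a signature and $\mathbb{M}$ a $\Sigma$-Nmatrix, with tilded Nmatrix $\widetilde{\mathbb{M}}$. For every $\Gamma\cup\{A\}\subseteq L_\Sigma(P)$, $$\Gamma\vdash_{\widetilde{\mathbb{M}}}A\quad\text{if and only if}\quad A\in\Gamma\ \text{ or }\ A\in\mathsf{Thm}(\Sigma,\vdash_{\mathbb{M}}).$$
   Context: A signature $\Sigma$ is a family $\{\Sigma^{(k)}:k\in\mathbb{N}_0\}$ of sets of connectives indexed by arity. $P=\{p_i:i\in\mathbb{N}\}$ is the set of propositional variables, and $L_\Sigma(P)$ is the set of formulas built from $P$ using connectives in $\Sigma$. A $\Sigma$-Nmatrix is a triple $\mathbb{M}=\langle V,D,\cdot_{\mathbb{M}}\rangle$ with $V$ a non-empty set of truth-values, $D\subseteq V$ the designated values, and, for each $c\in\Sigma^{(k)}$, a multi-function $c_{\mathbb{M}}:V^k\to 2^V\setminus\{\emptyset\}$. A valuation of $\mathbb{M}$ is a function $v:L_\Sigma(P)\to V$ with $v(c(A_1,\dots,A_k))\in c_{\mathbb{M}}(v(A_1),\dots,v(A_k))$ for all $k\in\mathbb{N}_0$, $c\in\Sigma^{(k)}$ and formulas $A_1,\dots,A_k$. $\Gamma\vdash_{\mathbb{M}}A$ iff every valuation $v$ of $\mathbb{M}$ with $v(\Gamma)\subseteq D$ satisfies $v(A)\in D$. $\mathsf{Thm}(\Sigma,\vdash_{\mathbb{M}})=\{A\in L_\Sigma(P):\emptyset\vdash_{\mathbb{M}}A\}$. The tilded Nmatrix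 $\widetilde{\mathbb{M}}=\langle\widetilde{V},\widetilde{D},\cdot_{\widetilde{\mathbb{M}}}\rangle$ adds to $\mathbb{M}$ a new designated copy $\widetilde{x}$ of each undesignated value $x\in V\setminus D$ (the $\widetilde{x}$ being pairwise distinct and not in $V$): $\widetilde{V}=V\cup\{\widetilde{x}:x\in V\setminus D\}$, $\widetilde{D}=D\cup\{\widetilde{x}:x\in V\setminus D\}$, and for $c\in\Sigma^{(k)}$ and $x_1,\dots,x_k\in\widetilde{V}$, $c_{\widetilde{\mathbb{M}}}(x_1,\dots,x_k)=u^{-1}(c_{\mathbb{M}}(u(x_1),\dots,u(x_k)))$, where $u:\widetilde{V}\to V$ is given by $u(x)=x$ for $x\in V$ and $u(\widetilde{x})=x$ for $x\in V\setminus D$, and $u^{-1}$ denotes preimage. *)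

(* Defs.v *)
From mathcomp Require Import all_boot.
From mathcomp Require Import boolp classical_sets.

Set Implicit Arguments.
Unset Strict Implicit.
Unset Printing Implicit Defensive.

Local Open Scope classical_set_scope.

(* [Sigma k] is the set of connectives of arity [k]. *)
Definition signature := nat -> Type.

(* Argument lists of length [k] are finite functions on ['I_k] ([T ^ k] is
   [{ffun 'I_k -> T}]): they are compatible with nested induction, unlike
   [k.-tuple T], and pointwise equal lists are Leibniz equal. *)
Inductive formula (Sigma : signature) : Type :=
  | Var of nat
  | Conn (k : nat) of Sigma k & formula Sigma ^ k.

Record nmatrix (Sigma : signature) := Nmatrix {
  value : Type;
  designated : set value;
  interp : forall k, Sigma k -> value ^ k -> set value;
  value_neq0 : [set: value] !=set0;
  interp_neq0 : forall k (c : Sigma k) (x : value ^ k), interp c x !=set0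
}.

Definition valuation (Sigma : signature) (M : nmatrix Sigma)
    (v : formula Sigma -> value M) : Prop :=
  forall (k : nat) (c : Sigma k) (B : formula Sigma ^ k),
    interp c [ffun i => v (B i)] (v (Conn c B)).

Definition entails (Sigma : signature) (M : nmatrix Sigma)
    (Gamma : set (formula Sigma)) (A : formula Sigma) : Prop :=
  forall v : formula Sigma -> value M, valuation v ->
    v @` Gamma `<=` @designated Sigma M -> @designated Sigma M (v A).

Definition Thm (Sigma : signature) (M : nmatrix Sigma) : set (formula Sigma) :=
  [set A | entails M set0 A].

Section Tilde.
Variables (Sigma : signature) (M : nmatrix Sigma).

(* [inl x] is the original value [x]; [inr x] is the new copy of the
   undesignated value [x]. *)
Definition tilde_value : Type := value M + set_type (~` @designated Sigma M).

Definition untilde (x : tilde_value) : value M :=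
  match x with inl y => y | inr y => val y end.

Definition tilde_designated : set tilde_value :=
  inl @` @designated Sigma M `|` range inr.

Definition tilde_interp (k : nat) (c : Sigma k) (x : tilde_value ^ k) :
    set tilde_value :=
  untilde @^-1` interp c [ffun i => untilde (x i)].

Lemma tilde_value_neq0 : [set: tilde_value] !=set0.
Proof. by have [x _] := value_neq0 M; exists (inl x). Qed.

Lemma tilde_interp_neq0 (k : nat) (c : Sigma k) (x : tilde_value ^ k) :
  tilde_interp c x !=set0.
Proof.
by have [y cy] := interp_neq0 c [ffun i => untilde (x i)]; exists (inl y).
Qed.

Definition tilde : nmatrix Sigma :=
  @Nmatrix Sigma tilde_value tilde_designated tilde_interp
    tilde_value_neq0 tilde_interp_neq0.

End Tilde.

(* Main.v *)
Require Import Defs.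
From mathcomp Require Import all_boot.
From mathcomp Require Import boolp classical_sets.

Set Implicit Arguments.
Unset Strict Implicit.
Unset Printing Implicit Defensive.

Local Open Scope classical_set_scope.

(** The multi-functions of the tilded Nmatrix see their arguments and results
only through [untilde], so its valuations are exactly the liftings along
[untilde] of valuations of [M] ([valuation_tildeE]), and the values of the
different formulas can be lifted independently of each other.  Every value of
[M] has a designated lifting ([designated_lift]), whereas an undesignated value
also has an undesignated one.  So, when a valuation of [M] refutes [A], it can
be lifted to make every formula other than [A] designated and [A] undesignated:
no premise distinct from [A] helps to derive [A].  Conversely, every lifting of
a designated value is designated, hence the theorems of [M] remain theorems of
the tilded Nmatrix. *)

(** The choice between a value and its copy is invisible to [tilde_interp]
both in the arguments and in the result, so it imposes no constraint. *)
Lemma valuation_tildeE (Sigma : signature) (M : nmatrix Sigma)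
    (w : formula Sigma -> tilde_value M) :
  valuation (M := tilde M) w <-> valuation (M := M) (@untilde Sigma M \o w).
Proof.
have argsE k (B : formula Sigma ^ k) :
    [ffun i => untilde ([ffun j => w (B j)] i)]
    = [ffun i => (@untilde Sigma M \o w) (B i)].
  by apply/ffunP => i; rewrite !ffunE.
by split=> w_val k c B; have := w_val k c B; rewrite /= /tilde_interp /= argsE.
Qed.

Lemma designated_lift (Sigma : signature) (M : nmatrix Sigma) (x : value M) :
  exists2 y : tilde_value M, untilde y = x & tilde_designated y.
Proof.
have [Dx|nDx] := pselect (designated x).
  by exists (inl x) => //; left; exists x.
by exists (inr (exist _ x (mem_set nDx))) => //; right; exists (exist _ x (mem_set nDx)).
Qed.

Lemma tilde_designated_inl (Sigma : signature) (M : nmatrix Sigma)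
    (x : value M) :
  tilde_designated (inl x) <-> designated x.
Proof. by split=> [[[y Dy [<-]]|[y]]|Dx] //; left; exists x. Qed.

Lemma designated_untilde (Sigma : signature) (M : nmatrix Sigma)
    (y : tilde_value M) :
  designated (untilde y) -> tilde_designated y.
Proof. by case: y => [x /tilde_designated_inl|x _] //; right; exists x. Qed.

(** The countermodel: since the values of a lifting are free at each formula,
designation can be forced everywhere except at [A]. *)
Lemma lift_valuation_except (Sigma : signature) (M : nmatrix Sigma)
    (v : formula Sigma -> value M) (A : formula Sigma) :
  valuation v ->
  exists w : formula Sigma -> tilde_value M,
    [/\ valuation (M := tilde M) w, w A = inl (v A)
      & forall B, B <> A -> tilde_designated (w B)].
Proof.
move=> v_val.
have /choice [w w_spec] : forall B, exists y : tilde_value M,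
    [/\ untilde y = v B, B = A -> y = inl (v B)
      & B <> A -> tilde_designated y].
  move=> B; have [->|nBA] := pselect (B = A); first by exists (inl (v A)).
  by have [y yE Dy] := designated_lift (v B); exists y.
exists w; split=> [||B nBA]; last by case: (w_spec B) => _ _; apply.
- apply/valuation_tildeE; suff -> : @untilde Sigma M \o w = v by [].
  by apply/funext => B; case: (w_spec B).
- by case: (w_spec A) => _ ->.
Qed.

Theorem proposition17 (Sigma : signature) (M : nmatrix Sigma)
    (Gamma : set (formula Sigma)) (A : formula Sigma) :
  entails (tilde M) Gamma A <-> Gamma A \/ Thm M A.
Proof.
split=> [GA|[GA|thmA] w w_val wG].
- have [|nGA] := pselect (Gamma A); [by left|right=> v v_val _].
  have [w [w_val wA wD]] := lift_valuation_except A v_val.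
  apply/tilde_designated_inl; rewrite -wA; apply: (GA w w_val) => _ [B GB <-].
  by apply: wD => BA; apply: nGA; rewrite -BA.
- by apply: wG; exists A.
- apply: designated_untilde; apply: (thmA (@untilde Sigma M \o w)).
    exact/valuation_tildeE.
  by move=> _ [B []].
Qed.
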